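(* Let $N$ and $f$ be integers with $0\le f<\frac{N}{3}$. In a partially synchronous message-passing system of $N$ processes $p_1,\dots,p_N$, at most $f$ of which are Byzantine (computationally bounded and possibly colluding), the RandSolomon protocol achieves Termination: eventually, every correct process decides on a value.
   Context: **System model.** There are $N$ processes $p_1,\dots,p_N$; $[N]=\{1,\dots,N\}$. At most $f<N/3$ of them are Byzantine: they may deviate arbitrarily from the protocol (including by omitting messages) and may collaborate, but have limited computing power. The other processes are correct. Processes communicate over point-to-point channels; every message sent is eventually delivered, and the system is partially synchronous (there is an unknown time after which message delays are bounded by an unknown constant). A broadcast is best-effort: the sender simply sends the message to every other process. **Primitives.** (i) Every process knows the public keys of all processes; each keeps its private key secret. $\{x\}_i$ denotes the *deterministic* public-key encryption of $x$ under $p_i$'s key (encrypting the same value twice under the same key gives the same ciphertext); it is decrypted with $p_i$'s private key, and a computationally bounded process without that key has negligible probability of determining the encrypted value. (ii) $(x)_i$ denotes $x$ together with a digital signature of $p_i$. (iii) Consensus tolerating $f$ Byzantine processes, with: Termination (eventually every correct process outputs a value), Agreement (no two correct processes output different values), and External Validity (only a value $v$ with $\mathit{valid}(v)$ can be output, where $\mathit{valid}(v)$ holds iff $v$ contains $N-f$ inputs signed by $N-f$ different processes). (iv) A Reed-Solomon code with deterministic encoding: symbols of $z$ bits, data of $b(N-f)$ symbols, code-words of $bN$ symbols ($bN\le 2^z-1$), able to correct up to $bf$ symbol erasures. A *block* is $b$ consecutive symbols, and $b\cdot z\ge 256$; a code-word $s$ has blocks $s[1],\dots,s[N]$. (v)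 Correct processes can locally generate uniformly random numbers. **RandSolomon, code for $p_i$.** Each handler is executed entirely before the next one is executed. Local variables: $\mathit{RNL}=\emptyset$; $\mathit{SEEN}=\emptyset$ (a map from process indices to values); $\sigma_i[1..N][1..N]=\bot$; $\mathit{RAND}_i=0$. *Generation and commitment phase.* Generate a random number $r_i$ of $b(N-f)$ symbols; encode $r_i$ into the code-word $s_i$; form $\underline{s_i}=(\{s_i[1]\}_1,\{s_i[2]\}_2,\dots,\{s_i[N]\}_N)_i$; broadcast $\langle\mathit{GENERATED},\underline{s_i}\rangle$. Upon receiving $\langle \mathit{GENERATED},\underline{s_j}\rangle$ (signed by $p_j$): set $\mathit{SEEN}[j]:=\underline{s_j}$; if $|\mathit{SEEN}|=N-f$, set $\mathit{RNL}:=\mathrm{Consensus}(\mathit{SEEN})$. *Reveal phase* (upon $\mathit{RNL}\ne\emptyset$). For each $\underline{s_j}\in \mathit{RNL}$, decrypt the $i$-th component of $\underline{s_j}$ into $s_j[i]$ and set $\sigma_i[j][i]:=s_j[i]$; then broadcast $\langle\mathit{REVEAL},(\sigma_i[\cdot][i])_i\rangle$. Upon receiving $\langle\mathit{REVEAL},(\sigma_j)_j\rangle$ with $j\ne i$ (processed after $\mathit{RNL}\neq\emptyset$): for each $\underline{s_k}\in\mathit{RNL}$, if $\{\sigma_j[k][j]\}_j$ equals the $j$-th component $\underline{s_k}[j]$ of $\underline{s_k}$, set $\sigma_i[k][j]:=\sigma_j[k][j]$. *Result computation phase* (upon $\mathit{RNL}\neq\emptyset$ and, for every $\underline{s_j}\in\mathit{RNL}$,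 there being $K\subseteq[N]$ with $|K|=N-f$ and $\sigma_i[j][k]\ne\bot$ for all $k\in K$). Set $\mathit{step}:=0$ and $\mathit{PRE}:=0$ ($N-f$ blocks). For each $\underline{s_j}\in\mathit{RNL}$ in increasing order of $j$: decode $\sigma_i[j]$ (entries $\bot$ treated as erasures) into $\tilde r_j$; if encoding $\tilde r_j$ and encrypting its $N$ blocks under the respective public keys does not reproduce $\underline{s_j}$, set $\tilde r_j:=0$; set $\mathit{PRE}:=\mathit{PRE}\oplus(\tilde r_j\gg\mathit{step})$, where $\gg \mathit{step}$ is the circular right shift by $\mathit{step}$ blocks; increment $\mathit{step}$. Finally, with $M=N-f$, set $\mathit{RAND}_i[k]:=\mathit{PRE}[2k-1]\oplus\mathit{PRE}[2k]$ for $1\le k\le\lfloor M/2\rfloor$, and, if $M$ is odd, additionally XOR $\mathit{PRE}[M]$ into the last block $\mathit{RAND}_i[\lfloor M/2\rfloor]$. Decide $\mathit{RAND}_i$. A phase begins when the first correct process enters it.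
   Formalization: Every component of a commitment, even a Byzantine one, is assumed to be a genuine encryption under the corresponding key, and a broadcast also reaches its own sender; without either assumption, silent Byzantine processes can prevent termination. *)

(* Defs.v *)
From HB Require Import structures.
From mathcomp Require Import all_boot all_order all_algebra.
Set Implicit Arguments.
Unset Strict Implicit.
Unset Printing Implicit Defensive.
Import GRing.Theory.
Local Open Scope ring_scope.

(** Conventions.  Processes are the elements of ['I_N] (numbered from 0).  A
    [z]-bit symbol is an element of a field with [2 ^ z] elements, so that the
    bitwise exclusive or of symbols (and of blocks) is the addition.  A block
    is a row of [b] symbols; a datum is a tuple of [N - f] blocks and a
    code-word a tuple of [N] blocks. *)

(** [encode] may be any encoding (systematic or not) onto a Reed-Solomon code.
    [decode] is total: nothing is known about its result on a word that is not
    an erasure of a code-word.  [None] stands for an erased symbol. *)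
Record reed_solomon (N f : nat) := ReedSolomon {
  z : nat;
  b : nat;
  symbol : finFieldType;
  symbol_card : #|symbol| = (2 ^ z)%N;
  length_bound : (b * N <= 2 ^ z - 1)%N;
  block_bits : (256 <= b * z)%N;
  point : 'I_N -> 'I_b -> symbol;
  point_neq0 : forall k t, point k t != 0;
  point_inj : forall k t k' t',
    point k t = point k' t' -> k = k' /\ t = t';
  encode : (N - f).-tuple 'rV[symbol]_b -> N.-tuple 'rV[symbol]_b;
  encode_rs : forall r, exists p : {poly symbol},
    (size p <= b * (N - f))%N /\
    forall k t, tnth (encode r) k 0 t = p.[point k t];
  decode : ('I_N -> 'I_b -> option symbol) -> (N - f).-tuple 'rV[symbol]_b;
  decode_erasures : forall r (w : 'I_N -> 'I_b -> option symbol),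
    (forall k t, w k t = None \/ w k t = Some (tnth (encode r) k 0 t)) ->
    (#|[set kt : 'I_N * 'I_b | w kt.1 kt.2 == None]| <= b * f)%N ->
    decode w = r
}.

Definition block N f (C : reed_solomon N f) : Type := 'rV[symbol C]_(b C).
Definition data N f (C : reed_solomon N f) : Type := (N - f).-tuple (block C).

(** [cipher i] is the set of encryptions under the public key of [i]: by
    [decK] each of its elements is the encryption of some plaintext.  Without
    this a Byzantine process could commit to a component that is no encryption
    at all, which no REVEAL would ever match. *)
Record encryption (N : nat) (plain : Type) := Encryption {
  cipher : 'I_N -> eqType;
  enc : forall i, plain -> cipher i;
  dec : forall i, cipher i -> plain;
  encK : forall i, cancel (@enc i) (@dec i);
  decK : forall i, cancel (@dec i) (@enc i)
}.

(** Unforgeability is not assumed: the computing power of Byzantine processes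
    is left unrestricted, so that all their feasible behaviours are covered. *)
Record signature (N : nat) (text : Type) := Signature {
  sig : Type;
  sign : 'I_N -> text -> sig;
  verify : 'I_N -> text -> sig -> bool;
  sign_verify : forall i x, verify i x (sign i x)
}.

Section Protocol.
Context (N f : nat) (C : reed_solomon N f) (E : encryption N (block C)).

Definition ciphers : Type := {dffun forall k : 'I_N, cipher E k}.
Definition column : Type := {ffun 'I_N -> option (block C)}.

Inductive text := CommitText of ciphers | RevealText of column.

Context (S : signature N text).

Record commitment := Commitment { components : ciphers; csig : sig S }.

Definition signed_by (j : 'I_N) (s : commitment) : bool :=
  verify j (CommitText (components s)) (csig s).

Definition registry : Type := {ffun 'I_N -> option commitment}.

Definition empty_registry : registry := [ffun=> None].

Definition registered (v : registry) : {set 'I_N} := [set j | isSome (v j)].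

Definition valid (v : registry) : bool :=
  (N - f <= #|[set j | if v j is Some s then signed_by j s else false]|)%N.

(** The process is the author in whose name the message is signed; the last
    argument of [Reveal] is the signature. *)
Inductive message :=
  | Generated of 'I_N & commitment
  | Reveal of 'I_N & column & sig S.

Definition rand_value : Type := (N - f)./2.-tuple (block C).

(** [proposal] is the argument of the call to the consensus, once made;
    [rnl] is [empty_registry] until that call returns.  [sigma (j, k)] is the
    value revealed by [k] for the code-word of [j]. *)
Record lstate := LState {
  started : bool;
  seen : registry;
  proposal : option registry;
  rnl : registry;
  sigma : {ffun 'I_N * 'I_N -> option (block C)};
  revealed : bool;
  decision : option rand_value
}.

Definition init_state : lstate :=
  LState false empty_registry None empty_registry [ffun=> None] false None.

Definition has_rnl (l : lstate) : bool := registered (rnl l) != set0.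

(** The call to the consensus takes place inside a handler, and no other
    handler is executed until it returns. *)
Definition waiting (l : lstate) : bool := isSome (proposal l) && ~~ has_rnl l.

Definition encrypt_all (r : data C) : ciphers :=
  finfun (fun k : 'I_N => enc E k (tnth (encode r) k)).

Definition commit (i : 'I_N) (r : data C) : commitment :=
  let c := encrypt_all r in Commitment c (sign S i (CommitText c)).

Definition do_generate (l : lstate) : lstate :=
  LState true (seen l) (proposal l) (rnl l) (sigma l) (revealed l) (decision l).

(** A process calls the (single-instance) consensus at most once. *)
Definition on_generated (j : 'I_N) (s : commitment) (l : lstate) : lstate :=
  if ~~ signed_by j s then l else
  let seen' : registry := [ffun k => if k == j then Some s else seen l k] in
  let proposal' :=
    if (#|registered seen'| == N - f)%N && ~~ isSome (proposal l)
    then Some seen' else proposal l in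
  LState (started l) seen' proposal' (rnl l) (sigma l) (revealed l) (decision l).

Definition on_output (v : registry) (l : lstate) : lstate :=
  LState (started l) (seen l) (proposal l) v (sigma l) (revealed l) (decision l).

Definition do_reveal (i : 'I_N) (l : lstate) : lstate :=
  let sigma' := [ffun jk : 'I_N * 'I_N =>
    if jk.2 == i then
      if rnl l jk.1 is Some s then Some (dec (components s i)) else sigma l jk
    else sigma l jk] in
  LState (started l) (seen l) (proposal l) (rnl l) sigma' true (decision l).

Definition revealed_column (i : 'I_N) (l : lstate) : column :=
  [ffun j => sigma l (j, i)].

Definition on_reveal (i j : 'I_N) (c : column) (g : sig S) (l : lstate) :
    lstate :=
  if ~~ verify j (RevealText c) g || (j == i) then l else
  let sigma' := [ffun kj : 'I_N * 'I_N =>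
    if kj.2 == j then
      match rnl l kj.1, c kj.1 with
      | Some s, Some x =>
          if enc E j x == components s j then Some x else sigma l kj
      | _, _ => sigma l kj
      end
    else sigma l kj] in
  LState (started l) (seen l) (proposal l) (rnl l) sigma' (revealed l)
    (decision l).

Definition zero_data : data C := [tuple 0 | _ < N - f].

Definition xor_data (x y : data C) : data C :=
  [tuple tnth x k + tnth y k | k < N - f].

Definition shift (n : nat) (x : data C) : data C :=
  [tuple of rotr (n %% (N - f)) x].

Definition recovered (l : lstate) (j : 'I_N) (s : commitment) : data C :=
  let r := decode (fun k t =>
    if sigma l (j, k) is Some x then Some (x 0 t) else None) in
  if [forall k, encrypt_all r k == components s k] then r else zero_data.

(** [enum 'I_N] lists the processes in increasing order; the second component
    of the accumulator is the local variable step. *)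
Definition pre_result (l : lstate) : data C :=
  (foldl (fun (acc : data C * nat) (j : 'I_N) =>
     if rnl l j is Some s
     then (xor_data acc.1 (shift acc.2 (recovered l j s)), acc.2.+1)
     else acc)
   (zero_data, 0%N) (enum 'I_N)).1.

Definition rand_result (l : lstate) : rand_value :=
  let M := (N - f)%N in
  let pre := tval (pre_result l) in
  [tuple nth 0 pre k.*2 + nth 0 pre k.*2.+1 +
         (if odd M && (k.+1 == M./2) then nth 0 pre M.-1 else 0) | k < M./2].

Definition computable (l : lstate) : Prop :=
  forall j, isSome (rnl l j) ->
    exists K : {set 'I_N}, #|K| = (N - f)%N /\
      forall k, k \in K -> isSome (sigma l (j, k)).

Definition do_compute (l : lstate) : lstate :=
  LState (started l) (seen l) (proposal l) (rnl l) (sigma l) (revealed l)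
    (Some (rand_result l)).

(** [Receive s m] handles the message [m] that was sent at step [s];
    [Output v] is the return of the consensus with value [v].  The argument of
    [Generate] is the number that was drawn; it may be any datum. *)
Inductive action :=
  | Generate of data C
  | Receive of nat & message
  | Output of registry
  | RevealAll
  | Compute.

Definition effect (i : 'I_N) (a : action) (l : lstate) : lstate :=
  match a with
  | Generate _ => do_generate l
  | Receive _ (Generated j s) => on_generated j s l
  | Receive _ (Reveal j c g) => on_reveal i j c g l
  | Output v => on_output v l
  | RevealAll => do_reveal i l
  | Compute => do_compute l
  end.

Definition broadcast (i : 'I_N) (a : action) (l : lstate) : option message :=
  match a with
  | Generate r => Some (Generated i (commit i r))
  | RevealAll =>
      let c := revealed_column i (do_reveal i l) in
      Some (Reveal i c (sign S i (RevealText c)))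
  | _ => None
  end.

(** [Deliver s i] puts the message sent to [i] at step [s] in the input buffer
    of [i].  In [Byzantine i out] process [i] sends [out k] to each [k]. *)
Inductive event :=
  | Idle
  | Deliver of nat & 'I_N
  | Byzantine of 'I_N & ('I_N -> option message)
  | Execute of 'I_N & action.

(** [state t] holds the local states before the [t]-th step; those of Byzantine
    processes are meaningless.  [clock t] is the instant of the [t]-th step;
    several steps may happen at the same instant. *)
Record run := Run {
  state : nat -> 'I_N -> lstate;
  step : nat -> event;
  clock : nat -> nat
}.

(** The message sent at step [t] to process [k], if any.  A broadcast also
    reaches its own sender. *)
Definition sent (R : run) (t : nat) (k : 'I_N) : option message :=
  match step R t with
  | Byzantine _ out => out k
  | Execute i a => broadcast i a (state R t i)
  | _ => None
  end.

Definition pending (R : run) (t : nat) (i : 'I_N) (s : nat) (m : message) :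
    Prop :=
  sent R s i = Some m /\
  (exists u, (u < t)%N /\ step R u = Deliver s i) /\
  (forall u m', (u < t)%N -> step R u <> Execute i (Receive s m')).

Definition enabled (R : run) (t : nat) (i : 'I_N) (a : action) : Prop :=
  let l := state R t i in
  match a with
  | Generate _ => ~~ started l
  | Receive s m =>
      started l /\ ~~ waiting l /\ pending R t i s m /\
      (if m is Reveal _ _ _ then has_rnl l else true)
  | Output _ => waiting l
  | RevealAll => started l && has_rnl l && ~~ revealed l
  | Compute => [/\ started l, has_rnl l, decision l = None & computable l]
  end.

Definition legal_step (byz : {set 'I_N}) (R : run) (t : nat) : Prop :=
  match step R t with
  | Idle => forall k, k \notin byz -> state R t.+1 k = state R t k
  | Deliver s i =>
      (s < t)%N /\ isSome (sent R s i) /\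
      forall k, k \notin byz -> state R t.+1 k = state R t k
  | Byzantine i _ =>
      i \in byz /\ forall k, k \notin byz -> state R t.+1 k = state R t k
  | Execute i a =>
      i \notin byz /\ enabled R t i a /\
      forall k, k \notin byz ->
        state R t.+1 k =
          if k == i then effect i a (state R t i) else state R t k
  end.

(** Units of work that a correct process does not postpone forever.  The
    return of the consensus is governed by [consensus_termination] instead. *)
Inductive task := TGenerate | TReceive of nat | TReveal | TCompute.

Definition task_of (a : action) : option task :=
  match a with
  | Generate _ => Some TGenerate
  | Receive s _ => Some (TReceive s)
  | Output _ => None
  | RevealAll => Some TReveal
  | Compute => Some TCompute
  end.

(** Correct processes do not stop: a task enabled forever gets executed. *)
Definition fair (byz : {set 'I_N}) (R : run) : Prop :=
  forall i k t, i \notin byz ->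
    (forall u, (t <= u)%N -> exists a, task_of a = Some k /\ enabled R u i a) ->
    exists u a, (t <= u)%N /\ task_of a = Some k /\ step R u = Execute i a.

Definition execution (byz : {set 'I_N}) (R : run) : Prop :=
  [/\ forall i, i \notin byz -> state R 0%N i = init_state,
      forall t, legal_step byz R t
    & fair byz R].

Definition reliable_channels (R : run) : Prop :=
  forall s k, isSome (sent R s k) -> exists t, step R t = Deliver s k.

(** A message sent before the instant [gst] arrives by [gst + delta]. *)
Definition partially_synchronous (R : run) : Prop :=
  [/\ {homo clock R : s t / (s <= t)%N},
      forall n, exists t, (n <= clock R t)%N
    & exists gst delta : nat, forall s k, isSome (sent R s k) ->
        exists t, step R t = Deliver s k /\
                  (clock R t <= maxn (clock R s) gst + delta)%N].

(** As usual, termination is granted when all correct processes take part,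
    with valid inputs. *)
Definition consensus_termination (byz : {set 'I_N}) (R : run) : Prop :=
  (forall i, i \notin byz ->
     exists t v, proposal (state R t i) = Some v /\ valid v) ->
  forall i, i \notin byz -> exists t v, step R t = Execute i (Output v).

Definition consensus_agreement (byz : {set 'I_N}) (R : run) : Prop :=
  forall i j t u v w, i \notin byz -> j \notin byz ->
    step R t = Execute i (Output v) -> step R u = Execute j (Output w) -> v = w.

Definition consensus_validity (byz : {set 'I_N}) (R : run) : Prop :=
  forall i t v, i \notin byz -> step R t = Execute i (Output v) -> valid v.

Definition consensus (byz : {set 'I_N}) (R : run) : Prop :=
  [/\ consensus_termination byz R, consensus_agreement byz R
    & consensus_validity byz R].

Definition termination (byz : {set 'I_N}) (R : run) : Prop :=
  forall i, i \notin byz ->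
    exists t v, decision (state R t i) = Some v.

End Protocol.

(* Main.v *)
Require Import Defs.
From mathcomp Require Import all_boot all_order all_algebra.
From Stdlib Require Import Classical.
Set Implicit Arguments.
Unset Strict Implicit.
Unset Printing Implicit Defensive.

(** The random number itself plays no role: a correct process decides as soon
    as it can compute.  If a correct process never called the consensus, it
    would never block, so it would register the commitments of the at least
    [N - f] correct processes; the size of its registry grows by at most one at
    a time, so it would hit [N - f] exactly and trigger the call.  Hence all
    correct processes propose valid registries, and all obtain the same one.
    Each of them then reveals its column, which passes every check because
    encryption is deterministic and both ends hold the same registry; these
    columns provide the [N - f] entries that the computation waits for. *)

(** Since [T] is finite, the maximum of the individual thresholds serves every [x]. *)
Lemma eventually_all (T : finType) (P : T -> nat -> Prop) :
  (forall x, exists t, forall u, (t <= u)%N -> P x u) ->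
  exists t, forall x u, (t <= u)%N -> P x u.
Proof.
move=> /fin_all_exists[h hP]; exists (\max_x h x)%N => x u le_u.
by apply: hP; apply: leq_trans le_u; apply: leq_bigmax.
Qed.

Section Execution.
Context (N f : nat) (C : reed_solomon N f) (E : encryption N (block C))
  (S : signature N (text E)) (byz : {set 'I_N}) (R : run S).
Context (R_exec : execution byz R).

(** * Single steps and facts that persist along an execution *)

Lemma step_local i t : i \notin byz ->
  state R t.+1 i = state R t i \/
  exists a, [/\ step R t = Execute i a, enabled R t i a
              & state R t.+1 i = effect i a (state R t i)].
Proof.
move=> ib; have [_ legal _] := R_exec.
move: (legal t); rewrite /legal_step; case Et: (step R t) => [|s k|k out|k a].
- by move=> H; left; apply: H.
- by move=> [_ [_ H]]; left; apply: H.
- by move=> [_ H]; left; apply: H.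
move=> [_ [en H]]; rewrite H //; case: eqP => [eik|_]; last by left.
by subst k; right; exists a.
Qed.

Lemma executed i a t : step R t = Execute i a ->
  [/\ i \notin byz, enabled R t i a
    & state R t.+1 i = effect i a (state R t i)].
Proof.
move=> Et; have [_ legal _] := R_exec.
move: (legal t); rewrite /legal_step Et => -[ib [en H]].
by split => //; rewrite H // eqxx.
Qed.

(** Induction on time. Preservation may use that the action is enabled, which matters for
    [rnl_stable]. *)
Lemma stable (P : lstate S -> Prop) i : i \notin byz ->
  (forall t a, enabled R t i a -> P (state R t i) ->
     P (effect i a (state R t i))) ->
  forall t u, (t <= u)%N -> P (state R t i) -> P (state R u i).
Proof.
move=> ib H t u /subnKC <-; elim: (u - t)%N => [|n IHn] Pt; first by rewrite addn0.
rewrite addnS; case: (step_local (t + n) ib) => [->|[a [_ en ->]]]; first exact: IHn.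
by apply: H => //; apply: IHn.
Qed.

Lemma started_stable i t u : i \notin byz -> (t <= u)%N ->
  started (state R t i) -> started (state R u i).
Proof.
move=> ib; apply: (stable (P := fun l => started l)) => // v.
case=> [r|s [j c|j c g]|w||] _ //=; rewrite /on_generated /on_reveal.
- by case: ifP.
- by case: ifP.
Qed.

Lemma registered_stable i j t u : i \notin byz -> (t <= u)%N ->
  j \in registered (seen (state R t i)) -> j \in registered (seen (state R u i)).
Proof.
move=> ib; apply: (stable (P := fun l => j \in registered (seen l))) => // v.
case=> [r|s [k c|k c g]|w||] _ //=; rewrite /on_generated /on_reveal.
- by case: ifP => // _; rewrite !inE ffunE; case: ifP.
- by case: ifP.
Qed.

Lemma sigma_stable i jk t u : i \notin byz -> (t <= u)%N ->
  isSome (sigma (state R t i) jk) -> isSome (sigma (state R u i) jk).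
Proof.
move=> ib; apply: (stable (P := fun l => isSome (sigma l jk))) => // v.
case=> [r|s [k c|k c g]|w||] _ //=; rewrite /on_generated /on_reveal.
- by case: ifP.
- case: ifP => // _; rewrite ffunE; case: ifP => // _.
  by case: (rnl _ _) => // x; case: (c _) => // y; case: ifP.
by rewrite ffunE; case: ifP => // _; case: (rnl _ _).
Qed.

(** Only [Output] writes [rnl], and it is enabled only while [rnl] is still empty. *)
Lemma rnl_stable i t u : i \notin byz -> (t <= u)%N ->
  has_rnl (state R t i) -> rnl (state R u i) = rnl (state R t i).
Proof.
(* Freezing the value at time [t] makes the equation a predicate of a single state. *)
move=> ib tu ht; move: tu (erefl (rnl (state R t i))).
apply: (stable (P := fun l => rnl l = rnl (state R t i))) => // v.
case=> [r|s [k c|k c g]|w||] /= + Ev //; rewrite /on_generated /on_reveal.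
- by case: ifP.
- by case: ifP.
by rewrite /waiting /has_rnl Ev => /andP[_]; rewrite [X in ~~ X]ht.
Qed.

Lemma has_rnl_stable i t u : i \notin byz -> (t <= u)%N ->
  has_rnl (state R t i) -> has_rnl (state R u i).
Proof. by move=> ib tu ht; rewrite /has_rnl (rnl_stable ib tu ht). Qed.

(** * Fairness, tracing of flags and message delivery *)

(** If [Q] never held, task [k] would stay enabled from [t] on; fairness would then execute it,
    which establishes [Q]. *)
Lemma fair_leads_to i k t (Q : nat -> Prop) : i \notin byz ->
  (forall u, (t <= u)%N -> ~ Q u ->
     exists a, task_of a = Some k /\ enabled R u i a) ->
  (forall u a, (t <= u)%N -> task_of a = Some k -> step R u = Execute i a ->
     Q u.+1) ->
  exists u, (t <= u)%N /\ Q u.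
Proof.
move=> ib en ex; apply: NNPP => nQ; have [_ _ fairR] := R_exec.
have [u tu|u [a [tu [ak Eu]]]] := fairR i k t ib.
  by apply: en => // Qu; apply: nQ; exists u.
by apply: nQ; exists u.+1; split; [apply: leqW | apply: ex Eu].
Qed.

Lemma eventually_started i : i \notin byz -> exists t, started (state R t i).
Proof.
move=> ib; have [u _|u a _|u [_ ?]] := @fair_leads_to i TGenerate 0
    (fun u => started (state R u i)) ib; last by exists u.
  (* Any datum can stand for the number drawn: enabledness does not depend on it. *)
  by move=> ns; exists (Generate S (zero_data C)); split=> //=; apply/negP.
by case: a => // r _ /executed[_ _ ->].
Qed.

(** The flag is false initially and only [Generate] raises it, so going back in time finds the step
    that did. *)
Lemma started_generate i t : i \notin byz -> started (state R t i) ->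
  exists s r, step R s = Execute i (Generate S r).
Proof.
move=> ib; have [init _ _] := R_exec.
elim: t => [|t IHt]; first by rewrite init.
case: (step_local t ib) => [->//|[a [Et _ ->]]].
case: a Et => [r Et _|s [j c|j c g] _ /=|v _|_|_] //; first by exists t, r.
- by rewrite /on_generated; case: ifP => // _; apply: IHt.
- by rewrite /on_reveal; case: ifP => // _; apply: IHt.
Qed.

Lemma revealed_reveal i t : i \notin byz -> revealed (state R t i) ->
  exists s, step R s = Execute i (RevealAll S).
Proof.
move=> ib; have [init _ _] := R_exec.
elim: t => [|t IHt]; first by rewrite init.
case: (step_local t ib) => [->//|[a [Et _ ->]]].
case: a Et => [r|s [j c|j c g] _ /=|v|Et _|] //; last by exists t.
- by rewrite /on_generated; case: ifP.
- by rewrite /on_reveal; case: ifP.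
Qed.

Lemma eventually_received i s m t : reliable_channels R -> i \notin byz ->
  sent R s i = Some m ->
  (forall u, (t <= u)%N ->
     [/\ started (state R u i), ~~ waiting (state R u i)
       & if m is Reveal _ _ _ then has_rnl (state R u i) else true]) ->
  exists u, step R u = Execute i (Receive s m).
Proof.
move=> rel ib sm ready.
(* A task fixes only the sending step [s]; the message handled is then determined by [sent]. *)
have receivedE u m' : step R u = Execute i (Receive s m') -> m' = m.
  by move=> /executed[_ [_ [_ [[+ _] _]]] _]; rewrite sm => -[].
have [d Ed] : exists d, step R d = Deliver S s i by apply: rel; rewrite sm.
(* The target does not depend on time: as long as it fails, the message delivered at [d] stays
   pending. *)
have [u tu nQ|u a _ ak Eu|u [_ []]] := @fair_leads_to i (TReceive s)
  (maxn t d.+1) (fun _ => exists u, step R u = Execute i (Receive s m)) ib.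
- exists (Receive s m); split=> //.
  move: tu; rewrite geq_max => /andP[tu du].
  have [st nw rn] := ready u tu; do !split=> //; first by exists d.
  move=> v m' _ Ev; apply: nQ; exists v.
  by rewrite Ev (receivedE v m').
- exists u; case: a ak Eu => // s' m' [->] Eu.
  by rewrite Eu (receivedE u m').
by move=> v Ev; exists v.
Qed.

(** * Commitment phase: every correct process calls the consensus *)

(** The last clause is why the registry meets size [N - f] exactly: before the call it is strictly
    smaller. *)
Definition proposal_inv (l : lstate S) : Prop :=
  [/\ forall j s, seen l j = Some s -> signed_by j s,
      forall v, proposal l = Some v -> valid v
    & proposal l = None -> (#|registered (seen l)| < N - f)%N].

Lemma on_generated_inv j s (l : lstate S) :
  proposal_inv l -> proposal_inv (on_generated j s l).
Proof.
move=> inv_l; case: (inv_l) => seenP propP cardP; rewrite /on_generated.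
case: ifP => // /negbFE sj.
set seen' := finfun _.
have seen'P k c : seen' k = Some c -> signed_by k c.
  by rewrite ffunE; case: eqP => [-> [<-]//|_]; apply: seenP.
split=> //= [v|].
  (* All entries are verified on receipt, so each of the [N - f] registered ones counts for
     [valid]. *)
  case: ifP => [/andP[/eqP card_seen' _] [<-]|_]; last exact: propP.
  rewrite /valid -card_seen'; apply/subset_leq_card/subsetP => k.
  by rewrite !inE; case Ek: (seen' k) => [c|//] _; apply: seen'P.
case: ifP => // + no_prop; rewrite no_prop andbT => /negbT card_ne.
(* One message adds at most one index, so the size is at most [N - f]; having missed equality, it is
   still below. *)
rewrite ltn_neqAle card_ne /=; apply: leq_trans (cardP no_prop).
apply: leq_trans (_ : #|j |: registered (seen l)| <= _)%N.
  apply/subset_leq_card/subsetP => k; rewrite !inE ffunE.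
  by case: (k == j).
by rewrite cardsU1 -add1n leq_add2r leq_b1.
Qed.

Lemma proposal_invariant i t : (0 < N - f)%N -> i \notin byz ->
  proposal_inv (state R t i).
Proof.
move=> Nf ib; have [init _ _] := R_exec.
apply: (stable (P := proposal_inv) ib _ (leq0n t)) => [u a _|].
  case: a => [r|s [j c|j c g]|v||] //=; first exact: on_generated_inv.
  by rewrite /on_reveal; case: ifP.
rewrite init //; split=> //= [j s|_]; first by rewrite ffunE.
(* The empty registry satisfies the strict bound because [0 < N - f]. *)
rewrite (_ : registered _ = set0) ?cards0 //.
by apply/setP => j; rewrite !inE ffunE.
Qed.

Lemma receive_generated_registered i j s r t :
  step R t = Execute i (Receive s (Generated j (commit S j r))) ->
  j \in registered (seen (state R t.+1 i)).
Proof.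
move=> /executed[_ _ ->] /=.
by rewrite /on_generated /signed_by sign_verify /= !inE ffunE eqxx.
Qed.

Lemma eventually_proposed i : (0 < N - f)%N -> (N - f <= #|~: byz|)%N ->
  reliable_channels R -> i \notin byz ->
  exists t v, proposal (state R t i) = Some v /\ valid v.
Proof.
move=> Nf cardC rel ib; apply: NNPP => never.
(* By the invariant any proposal is valid, so there is none at all; hence the process is never
   [waiting] and stays able to receive. *)
have no_prop t : proposal (state R t i) = None.
  case Ev: (proposal _) => [v|//]; case: never; exists t, v; split=> //.
  by have [_ + _] := proposal_invariant t Nf ib; apply.
have [t0 st0] := eventually_started ib.
have [t tP] : exists t, forall j u, (t <= u)%N -> j \notin byz ->
    j \in registered (seen (state R u i)).
  apply: eventually_all => j; have [jb|jb] := boolP (j \in byz).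
    by exists 0%N.
  have [t1 /(started_generate jb)[s [r Es]]] := eventually_started jb.
  have [|t2 t0t2|u Eu] := @eventually_received i s
    (Generated j (commit S j r)) t0 rel ib.
  - by rewrite /sent Es.
  - by split=> //; [apply: started_stable st0 | rewrite /waiting no_prop].
  exists u.+1 => v uv _; apply: registered_stable uv _ => //.
  exact: receive_generated_registered Eu.
(* The registry contains all correct processes, at least [N - f] of them, against the last clause of
   the invariant. *)
have [_ _ /(_ (no_prop t))] := proposal_invariant t Nf ib.
rewrite ltnNge => /negP; apply; apply: leq_trans cardC _.
by apply/subset_leq_card/subsetP => j; rewrite inE; apply: tP.
Qed.

(** * Consensus: a common registry *)

(** An empty registry encodes that the consensus has not returned, so a valid output must be told
    apart from it. *)
Lemma valid_registered_neq0 (v : registry S) :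
  (0 < N - f)%N -> valid v -> registered v != set0.
Proof.
move=> Nf vv; rewrite -card_gt0; apply: leq_trans Nf (leq_trans vv _).
by apply/subset_leq_card/subsetP => k; rewrite !inE; case: (v k).
Qed.

Lemma common_rnl : (0 < N - f)%N -> (N - f <= #|~: byz|)%N ->
  reliable_channels R -> consensus byz R ->
  exists v, forall i, i \notin byz ->
    (exists t, has_rnl (state R t i)) /\
    (forall t, has_rnl (state R t i) -> rnl (state R t i) = v).
Proof.
move=> Nf cardC rel [term agree validity].
have out i : i \notin byz -> exists t v, step R t = Execute i (Output v).
  by apply: term => j; apply: eventually_proposed.
(* Since [0 < N - f], there is a correct process [i0]; its output serves as the common value. *)
have /set0Pn[i0] : ~: byz != set0 by rewrite -card_gt0; apply: leq_trans cardC.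
rewrite inE => ib0; have [t0 [v Ev0]] := out i0 ib0.
exists v => i ib; have [t [w Ew]] := out i ib.
have wv : w = v by apply: agree Ew Ev0.
subst w; have [_ _ Et] := executed Ew.
have rnl_t : rnl (state R t.+1 i) = v by rewrite Et.
have has_t : has_rnl (state R t.+1 i).
  rewrite /has_rnl rnl_t; apply: valid_registered_neq0 => //.
  exact: validity Ew.
split=> [|u has_u]; first by exists t.+1.
(* Stability applies whether [u] lies after or before the return of the consensus. *)
have [tu|/ltnW ut] := leqP t.+1 u; first by rewrite (rnl_stable ib tu).
by rewrite -rnl_t (rnl_stable ib ut).
Qed.

(** * Reveal phase: the columns of correct processes *)

Lemma eventually_revealed i : i \notin byz ->
  (exists t, has_rnl (state R t i)) ->
  exists s, step R s = Execute i (RevealAll S).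
Proof.
move=> ib [t1 has1]; have [t0 st0] := eventually_started ib.
have [u tu|u a _|u [_ /(revealed_reveal ib)[s Es]]] :=
  @fair_leads_to i TReveal (maxn t0 t1) (fun u => revealed (state R u i)) ib.
- move=> nr; exists (RevealAll S); split=> //=.
  move: tu; rewrite geq_max => /andP[t0u t1u].
  by rewrite (started_stable ib t0u st0) (has_rnl_stable ib t1u has1); apply/negP.
- by case: a => // _ /executed[_ _ ->].
by exists s.
Qed.

(** A process discards [Reveal] messages in its own name, so its own column must come from
    [RevealAll] itself. *)
Lemma reveal_own_sigma i k s : step R s = Execute i (RevealAll S) ->
  isSome (rnl (state R s i) k) -> isSome (sigma (state R s.+1 i) (k, i)).
Proof.
by move=> /executed[_ _ ->] /=; rewrite ffunE /= eqxx; case: (rnl _ k).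
Qed.

Definition reveal_message i (l : lstate S) : message S :=
  let c := revealed_column i (do_reveal i l) in
  Reveal i c (sign S i (RevealText E c)).

(** The sender decrypts the component that the receiver compares with; as the registries are equal,
    [decK] makes the check succeed. The index [0] is arbitrary, as [effect] does not depend on
    it. *)
Lemma receive_reveal_sigma i j k (l l' : lstate S) : j != i ->
  rnl l = rnl l' -> isSome (rnl l k) ->
  isSome (sigma (effect i (Receive 0 (reveal_message j l')) l) (k, j)).
Proof.
move=> ji eq_rnl; rewrite /= /on_reveal sign_verify (negbTE ji) /= ffunE /= eqxx.
rewrite !ffunE /= eqxx -eq_rnl.
by case: (rnl l k) => // s _; rewrite decK eqxx.
Qed.

Lemma eventually_sigma v i j : reliable_channels R ->
  (forall i, i \notin byz ->
    (exists t, has_rnl (state R t i)) /\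
    (forall t, has_rnl (state R t i) -> rnl (state R t i) = v)) ->
  i \notin byz -> j \notin byz ->
  exists t, forall k, isSome (v k) -> isSome (sigma (state R t i) (k, j)).
Proof.
move=> rel rnlP ib jb.
have [hasj rnlj] := rnlP j jb; have [[t1 has1] rnli] := rnlP i ib.
have [s Es] := eventually_revealed jb hasj.
have [_ /= /andP[/andP[_ hass] _] _] := executed Es.
have [eij|ji] := eqVneq j i.
  subst j; exists s.+1 => k vk; apply: reveal_own_sigma => //.
  by rewrite rnlj.
have [t0 st0] := eventually_started ib.
have [|u tu|u Eu] := @eventually_received i s
  (reveal_message j (state R s j)) (maxn t0 t1) rel ib.
- by rewrite /sent Es.
- move: tu; rewrite geq_max => /andP[t0u t1u].
  have hasu := has_rnl_stable ib t1u has1.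
  by split=> //; [apply: started_stable st0 | rewrite /waiting hasu andbF].
(* A [Reveal] is handled only once [rnl] is set, so the receiver checks against the same [v] that
   the sender used. *)
have [_ [_ [_ [_ hasu]]] Eu1] := executed Eu.
exists u.+1 => k vk; rewrite Eu1; apply: receive_reveal_sigma => //.
  by rewrite rnlj // rnli.
by rewrite rnli.
Qed.

(** * Result computation and conclusion *)

Lemma eventually_decided v i : (N - f <= #|~: byz|)%N ->
  reliable_channels R ->
  (forall i, i \notin byz ->
    (exists t, has_rnl (state R t i)) /\
    (forall t, has_rnl (state R t i) -> rnl (state R t i) = v)) ->
  i \notin byz -> exists t w, decision (state R t i) = Some w.
Proof.
move=> cardC rel rnlP ib; have [[t1 has1] rnli] := rnlP i ib.
have [t0 st0] := eventually_started ib.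
have [t tP] : exists t, forall j u, (t <= u)%N -> j \notin byz ->
    forall k, isSome (v k) -> isSome (sigma (state R u i) (k, j)).
  apply: eventually_all => j; have [jb|jb] := boolP (j \in byz).
    by exists 0%N.
  have [t2 t2P] := eventually_sigma rel rnlP ib jb.
  by exists t2 => u tu _ k /t2P; apply: sigma_stable.
have [u|u a _|u [_ [w Ew]]] := @fair_leads_to i TCompute
  (maxn (maxn t0 t1) t) (fun u => exists w, decision (state R u i) = Some w) ib.
- rewrite !geq_max => /andP[/andP[t0u t1u] tu] undecided.
  exists (Compute S); split=> //; split.
  + exact: started_stable st0.
  + exact: has_rnl_stable has1.
  + by case Ew: (decision _) => [w|//]; case: undecided; exists w.
  move=> j; rewrite rnli; last exact: has_rnl_stable has1.
  (* [computable] wants exactly [N - f] indices, so that many distinct correct processes are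
     selected for [K]. *)
  move=> vj; have /card_geqP[K [uniqK sizeK sub]] := cardC.
  exists [set k in K]; split=> [|k]; first by rewrite cardsE (card_uniqP uniqK).
  by rewrite inE => /sub; rewrite inE => kb; apply: tP.
- by case: a => // _ /executed[_ _ ->]; eexists.
by exists u, w.
Qed.

End Execution.

Theorem proposition4 (N f : nat)
    (C : reed_solomon N f) (E : encryption N (block C))
    (S : signature N (text E))
    (byz : {set 'I_N}) (R : run S)
    (f_lt : (3 * f < N)%N)
    (byz_le : (#|byz| <= f)%N)
    (R_exec : execution byz R)
    (R_reliable : reliable_channels R)
    (R_psync : partially_synchronous R)
    (R_consensus : consensus byz R) :
  termination byz R.
Proof.
have Nf : (0 < N - f)%N.
  by rewrite subn_gt0; apply: leq_ltn_trans f_lt; apply: leq_pmull.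
have cardC : (N - f <= #|~: byz|)%N.
  by rewrite cardsCs setCK card_ord leq_sub2l.
have [v rnlP] := common_rnl R_exec Nf cardC R_reliable R_consensus.
by move=> i; apply: eventually_decided rnlP.
Qed.
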